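(* Let $n$ be a positive integer and let $m\ge 3$ be an integer. For maps $\phi_i:\mathbf{DS}_n\to\mathbf{DS}_n$ ($i=1,\ldots,m$), the following are equivalent: (1) $\operatorname{tr}(\phi_1(A_1)\phi_2(A_2)\cdots\phi_m(A_m))=\operatorname{tr}(A_1A_2\cdots A_m)$ for all $A_1,\ldots,A_m\in\mathbf{DS}_n$. (2) $\operatorname{spec}(\phi_1(A_1)\phi_2(A_2)\cdots\phi_m(A_m))=\operatorname{spec}(A_1A_2\cdots A_m)$ for all $A_1,\ldots,A_m\in\mathbf{DS}_n$. (3) There exist permutation matrices $P_1,P_2,\ldots,P_m,P_{m+1}\in\mathbf{P}_n$ with $P_{m+1}=P_1$ such that $\phi_i(A)=P_iAP_{i+1}^t$ for all $A\in\mathbf{DS}_n$ and all $i\in\{1,\ldots,m\}$.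
   Context: $\mathbf{DS}_n$ is the set of $n\times n$ doubly stochastic matrices (real, entrywise nonnegative, all row sums and all column sums equal to $1$) and $\mathbf{P}_n$ is the set of $n\times n$ permutation matrices. $A^t$ is the transpose of $A$. $\operatorname{spec}(A)$ is the spectrum (multiset of complex eigenvalues) of $A$ counting multiplicities. The maps $\phi_i$ are not assumed linear. *)

(* Defs.v *)
From HB Require Import structures.
From mathcomp Require Import all_boot all_order all_algebra.
From mathcomp Require Import finmap multiset complex reals.

Set Implicit Arguments.
Unset Strict Implicit.
Unset Printing Implicit Defensive.

Import Order.TTheory GRing.Theory Num.Theory.

Local Open Scope ring_scope.

Section DoublyStochastic.

Variables (R : realType) (n : nat).

Definition doubly_stochastic (A : 'M[R]_n) : bool :=
  [&& [forall i, forall j, 0 <= A i j],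
      [forall i, \sum_j A i j == 1]
    & [forall j, \sum_i A i j == 1]].

Record DS : Type := MkDS {
  DS_mx :> 'M[R]_n;
  DS_mxP : doubly_stochastic DS_mx
}.

HB.instance Definition _ := [isSub for DS_mx].
HB.instance Definition _ := [Choice of DS by <:].

End DoublyStochastic.

Section Spectrum.

Variables (C : closedFieldType) (n : nat).

Definition spectrum (B : 'M[C]_n) : {mset C}%mset :=
  seq_mset (sval (closed_field_poly_normal (char_poly B))).

(* [spectrum B] does not depend on the factorization chosen by
   [closed_field_poly_normal]. *)
Lemma spectrumP (B : 'M[C]_n) (s : seq C) :
  reflect (char_poly B = \prod_(z <- s) ('X - z%:P))
          (spectrum B == seq_mset s).
Proof.
rewrite /spectrum; case: closed_field_poly_normal => r /=.
rewrite (monicP (char_poly_monic B)) scale1r => ->.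
apply: (iffP eqP) => [/eq_seq_msetP /(perm_big _) -> // | Ers].
exact/eq_seq_msetP/prod_XsubC_eq.
Qed.

End Spectrum.

Definition spec (R : realType) (n : nat) (A : 'M[R]_n) : {mset R[i]}%mset :=
  spectrum (map_mx (real_complex R) A).

(* Main.v *)
Require Import Defs.
From HB Require Import structures.
From mathcomp Require Import all_boot all_order all_fingroup all_algebra.
From mathcomp Require Import finmap multiset complex reals.

Set Implicit Arguments.
Unset Strict Implicit.
Unset Printing Implicit Defensive.

Import Order.TTheory GRing.Theory Num.Theory.

(** The cycle of implications is closed by going from traces to permutation
matrices; the other two steps are elementary. If [phi i A] is
[P i * A * (P (i+1))^T], the products telescope to a conjugate of the original
product ([big_ord_telescope]), which has the same characteristic polynomial,
and the trace is minus a coefficient of that polynomial.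

Suppose now that the maps preserve traces of products. The first point is that
each [phi i] sends permutation matrices to permutation matrices. A doubly
stochastic matrix has entries at most 1, so its trace is at most [n], and
equals [n] only for the identity ([doubly_stochastic_trace_max]). Put a
permutation matrix in slot [i], its inverse in another slot and the identity
elsewhere: the images multiply to a doubly stochastic matrix of trace [n],
hence to the identity. A product of doubly stochastic matrices is a
permutation matrix only if every factor is ([doubly_stochastic_prod_perm]).

The maps thus restrict to maps [sigma i] on the symmetric group such that the
products [sigma 1 (s 1) ... sigma m (s m)] and [s 1 ... s m] always have as
many fixed points. Multiplying [sigma i] on both sides by partial products of
the [sigma k 1] makes every [sigma i] fix the identity without changing the
total product. After this, a product equal to 1 is sent to a product equal to
1. Inserting [a] and its inverse in two slots shows that all [sigma i]
coincide, any two being compared through a third; inserting [a], [b] and the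
inverse of [a * b] in three slots shows that they are one and the same
endomorphism [psi] of the symmetric group. Both arguments need [m >= 3]. As [psi] keeps numbers of fixed
points, it is injective and maps transpositions to transpositions, so it is
inner ([fixpts_morph_inner]): the transpositions through one point are
pairwise non-commuting, and their images must all go through one point as
well. This yields permutations [p i] with
[sigma i a = p i * a * (p (i+1))^-1] ([fixpts_prod_inner]).

It remains to pass from permutation matrices to all doubly stochastic
matrices. Undoing the [p i], the matrix obtained from [phi i A] has the same
trace pairing with every permutation matrix as [A]; the difference has zero
row and column sums, and such a matrix is determined by these pairings
([mxtrace_perm_eq0]). *)

(** * Ordered products in a monoid *)

Section MonoidProducts.
Variables (M : Type) (idx : M) (op : Monoid.law idx).

(** Stated in a monoid in order to serve both for permutations and for square
matrices, which carry different product structures. *)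
Lemma big_ord_telescope (m : nat) (p q : nat -> M) (F : 'I_m -> M) :
  (forall k, op (q k) (p k) = idx) -> op (p 0) (q 0) = idx ->
  \big[op/idx]_(i < m) op (op (p i) (F i)) (q i.+1) =
  op (op (p 0) (\big[op/idx]_(i < m) F i)) (q m).
Proof.
move=> qp pq0; elim: m F => [|m IHm] F.
  by rewrite !big_ord0 Monoid.mulm1 pq0.
rewrite !big_ord_recr /= IHm !Monoid.mulmA /=.
by rewrite -[op (op _ (q m)) (p m)]Monoid.mulmA /= qp Monoid.mulm1.
Qed.

(** The product is not commutative, so the two nontrivial factors cannot be
extracted one after the other: the index sequence itself, being sorted, is
reduced to [:: i; j]. *)
Lemma big_ord_two (m : nat) (i j : 'I_m) (F : 'I_m -> M) :
  i < j -> (forall k, k != i -> k != j -> F k = idx) ->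
  \big[op/idx]_k F k = op (F i) (F j).
Proof.
move=> ltij F1; pose r := [:: i; j].
have -> : \big[op/idx]_k F k = \big[op/idx]_(k | k \in r) F k.
  rewrite [RHS]big_mkcond; apply: eq_bigr => k _.
  by rewrite !inE; case: eqP => //= /eqP ki; case: eqP => //= /eqP; apply: F1.
rewrite -big_filter.
suff -> : [seq k <- index_enum 'I_m | k \in r] = r.
  by rewrite big_cons big_seq1.
apply: (@irr_sorted_eq _ (relpre val ltn)).
- by move=> x y z; apply: ltn_trans.
- by move=> x; apply: ltnn.
- rewrite [index_enum _]unlock; apply: sorted_filter.
    by move=> x y z; apply: ltn_trans.
  by rewrite -enumT -sorted_map val_enum_ord; apply: iota_ltn_sorted.
- by rewrite /= ltij.
by move=> k; rewrite mem_filter mem_index_enum andbT.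
Qed.

Lemma big_ord_three (m : nat) (F : 'I_m.+3 -> M) :
  (forall k : 'I_m.+3, 2 < k -> F k = idx) ->
  \big[op/idx]_k F k =
  op (F ord0) (op (F (lift ord0 ord0)) (F (lift ord0 (lift ord0 ord0)))).
Proof.
move=> F1; rewrite !big_ord_recl big1 ?Monoid.mulm1 // => k _.
exact: F1.
Qed.

End MonoidProducts.

Local Open Scope group_scope.

Lemma ord_neq_ex m (i : 'I_m.+2) : exists j, j != i.
Proof.
have [->|i0] := eqVneq i ord0; first by exists ord_max.
by exists ord0; rewrite eq_sym.
Qed.

(** * Fixed points of permutations *)

Section FixedPoints.
Variable T : finType.
Implicit Types a b c : {perm T}.

Definition fixpts a := [set x | a x == x].

Lemma card_fixpts_max a : (#|fixpts a| == #|T|) = (a == 1).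
Proof.
apply/eqP/eqP => [fixT | ->]; last first.
  by apply: eq_card => x; rewrite !inE perm1 eqxx.
apply/permP=> x; rewrite perm1.
have/eqP : fixpts a = setT.
  by apply/eqP; rewrite eqEcard subsetT cardsT fixT leqnn.
by move/eqP/setP/(_ x); rewrite !inE => /eqP.
Qed.

Lemma card_fixpts_tperm (x y : T) : x != y ->
  #|fixpts (tperm x y)| = #|T| - 2.
Proof.
move=> xy; have -> : fixpts (tperm x y) = ~: [set x; y].
  apply/setP=> z; rewrite !inE.
  by case: tpermP => [->|->|/eqP/negPf-> /eqP/negPf->];
    rewrite ?eqxx ?orbT ?(negPf xy) // eq_sym (negPf xy).
by rewrite cardsCs setCK cards2 xy.
Qed.

(** The image of a moved point is moved too, so a permutation that moves only
two points exchanges [x] and [a x]. *)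
Lemma fixpts_tpermE a (x : T) : #|fixpts a| = #|T| - 2 -> a x != x ->
  a = tperm x (a x).
Proof.
move=> cfix ax.
have moved z : a z != z -> (z == x) || (z == a x).
  have Esupp : [set x; a x] = ~: fixpts a.
    apply/eqP; rewrite eqEcard; apply/andP; split.
      by apply/subsetP=> y; rewrite !inE => /orP[] /eqP->;
        rewrite ?(inj_eq perm_inj).
    rewrite cards2 eq_sym ax cardsCs setCK cfix.
    by rewrite leq_subLR addnC -leq_subLR.
  by move=> az; rewrite -in_set2 Esupp !inE.
apply/permP=> z; case: tpermP => [->|->|/eqP/negPf zx /eqP/negPf zax] //.
  have := moved (a (a x)); rewrite !(inj_eq perm_inj) (negPf ax) orbF.
  by move=> /(_ isT)/eqP.
by apply/eqP; apply: contraT => /moved; rewrite zx zax.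
Qed.

End FixedPoints.

(** * Endomorphisms of the symmetric group that keep numbers of fixed points *)

Section FixedPointPreservingMorphism.
Variables (T : finType) (x0 : T) (psi : {perm T} -> {perm T}).
Hypothesis psiM : {morph psi : a b / a * b}.
Hypothesis fix_psi : forall a, #|fixpts (psi a)| = #|fixpts a|.

Let psi1 : psi 1 = 1.
Proof. by apply: (mulgI (psi 1)); rewrite -psiM !mulg1. Qed.

Let psiV a : psi a^-1 = (psi a)^-1.
Proof. by apply: (mulgI (psi a)); rewrite -psiM !mulgV. Qed.

Let psiJ a b : psi (a ^ b) = psi a ^ psi b.
Proof. by rewrite !conjgE !psiM psiV. Qed.

Let psi_inj : injective psi.
Proof.
move=> a b eq_ab; apply/eqP; rewrite eq_mulgV1 -card_fixpts_max -fix_psi.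
by rewrite psiM psiV eq_ab mulgV card_fixpts_max.
Qed.

Let t x := tperm x0 x.

Let psi_tE x c : x != x0 -> psi (t x) c != c ->
  psi (t x) = tperm c (psi (t x) c).
Proof.
move=> xx0; apply: fixpts_tpermE.
by rewrite fix_psi card_fixpts_tperm // eq_sym.
Qed.

Let t_inj : injective t.
Proof. by move=> x y /permP/(_ x0); rewrite !tpermL. Qed.

Let t_conj x y : x != x0 -> x != y -> t x ^ t y = tperm y x.
Proof. by move=> xx0 xy; rewrite tpermJ tpermL tpermD // eq_sym. Qed.

(** Permutations with disjoint supports commute, whereas [t x] and [t y], and
hence their images under the injective [psi], do not. *)
Let star_meet x y : x != x0 -> y != x0 -> x != y ->
  exists c, psi (t x) c != c /\ psi (t y) c != c.
Proof.
move=> xx0 yx0 xy.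
have [/existsP[c /andP[]] | /existsPn dis] :=
  boolP [exists c, (psi (t x) c != c) && (psi (t y) c != c)]; first by exists c.
have : commute (psi (t x)) (psi (t y)).
  apply: (@perm_onC _ (~: fixpts (psi (t x))) (~: fixpts (psi (t y)))).
  - by apply/subsetP=> z; rewrite !inE.
  - by apply/subsetP=> z; rewrite !inE.
  rewrite disjoints_subset; apply/subsetP=> z; rewrite !inE => xz.
  by have := dis z; rewrite xz.
rewrite /commute -!psiM => /psi_inj xyC; move: (t_conj xx0 xy).
rewrite conjgE xyC mulKg.
move=> /permP/(_ x0); rewrite tpermL tpermD // => E; by rewrite E eqxx in xx0.
Qed.

(** Pairwise intersecting pairs all share a point or form a triangle. If
[psi (t x)], [psi (t y)], [psi (t z)] were the triangle [tperm a b],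
[tperm a c], [tperm b c], the third would be the conjugate of the first by the
second, so [t z] would be [t x ^ t y = tperm y x], which fixes [x0] although
[t z] does not. *)
Let star_center : exists c, forall x, x != x0 -> psi (t x) c != c.
Proof.
have [x xx0 | noT] := pickP (predC1 x0); last first.
  by exists x0 => x; have/= -> := noT x.
have [y /andP[yx0 yx] | noy] :=
  pickP [pred y | (y != x0) && (y != x)]; last first.
  have : exists c, psi (t x) c != c.
    apply/existsP; apply: contraT => /existsPn fx.
    have : psi (t x) = psi (t x0).
      rewrite /t tperm1 psi1; apply/permP=> z; rewrite perm1.
      by have := fx z; rewrite negbK => /eqP.
    by move/psi_inj/t_inj=> E; rewrite /= E eqxx in xx0.
  case=> c cx; exists c => z zx0; have := noy z; rewrite /= zx0 /= => /negbT.
  by rewrite negbK => /eqP->.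
have [|a [ax ay]] := star_meet xx0 yx0; first by rewrite eq_sym.
exists a => z zx0; apply/negP => /eqP az.
have zx : z != x by apply: contraNneq ax => <-; apply/eqP.
have zy : z != y by apply: contraNneq ay => <-; apply/eqP.
have Ex := psi_tE xx0 ax; have Ey := psi_tE yx0 ay.
set b := psi (t x) a in ax Ex; set c := psi (t y) a in ay Ey.
clearbody b c.
(* [psi (t z)] fixes the common point [a] but meets [psi (t w)], hence moves the
   other point of [psi (t w)]. *)
have moves w d : w != x0 -> z != w -> psi (t w) = tperm a d -> psi (t z) d != d.
  move=> wx0 zw Ew; have [e [ze]] := star_meet zx0 wx0 zw.
  rewrite Ew; case: tpermP => [Ea|Ed|]; last by rewrite eqxx.
    by rewrite Ea az eqxx in ze.
  by rewrite -Ed.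
have bc : b != c.
  by apply: contraNneq yx => bc; apply/eqP/t_inj/psi_inj; rewrite Ex Ey bc.
have bz := moves x b xx0 zx Ex; have cz := moves y c yx0 zy Ey.
have Ez := psi_tE zx0 bz.
have Ecz : psi (t z) b = c.
  by move: cz; rewrite {1}Ez; case: tpermP => // [/esym/eqP|_ _];
    rewrite ?(negPf bc) ?eqxx.
have : psi (t x) ^ psi (t y) = psi (t z).
  by rewrite Ex Ey Ez Ecz tpermJ tpermL tpermD 1?eq_sym // tpermC.
rewrite -psiJ => /psi_inj; rewrite t_conj //; last by rewrite eq_sym.
by move/permP/(_ x0); rewrite tpermL tpermD // => E; rewrite E eqxx in zx0.
Qed.

(** If [c] is the common point of the images [psi (t x)], the conjugating
permutation sends [x0] to [c] and [x] to the other point of [psi (t x)]; both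
cases are [x |-> psi (t x) c], as [t x0 = 1]. It is enough to check the
conjugation on the [t x], since they generate all transpositions. *)
Lemma fixpts_morph_inner : exists s : {perm T}, forall a, psi a = a ^ s.
Proof.
have [c cP] := star_center.
have s_inj : injective (fun x => psi (t x) c).
  move=> x y; have [->|xx0] := eqVneq x x0; have [->|yx0] := eqVneq y x0 => //.
  - by rewrite {1}/t tperm1 psi1 perm1 => E; have := cP _ yx0; rewrite -E eqxx.
  - by rewrite {2}/t tperm1 psi1 perm1 => E; have := cP _ xx0; rewrite E eqxx.
  move=> E; apply/t_inj/psi_inj.
  by rewrite (psi_tE xx0 (cP _ xx0)) E -(psi_tE yx0 (cP _ yx0)).
exists (perm s_inj).
have Et x : psi (t x) = t x ^ perm s_inj.
  rewrite tpermJ !permE /= {2}/t tperm1 psi1 perm1.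
  have [->|xx0] := eqVneq x x0; first by rewrite /t !tperm1 psi1 perm1 tperm1.
  exact: psi_tE (cP _ xx0).
have Etp x y : psi (tperm x y) = tperm x y ^ perm s_inj.
  have [->|xx0] := eqVneq x x0; first exact: Et.
  have [->|yx] := eqVneq y x; first by rewrite tperm1 psi1 conj1g.
  have <- : t x ^ t y = tperm x y by rewrite t_conj 1?tpermC // eq_sym.
  by rewrite psiJ !Et -conjJg.
move=> a; have [ts -> _] := prod_tpermP a.
elim: ts => [|xy ts IH]; first by rewrite big_nil psi1 conj1g.
by rewrite big_cons psiM conjMg IH Etp.
Qed.

End FixedPointPreservingMorphism.

(** * Families of maps that keep numbers of fixed points of products *)

Section FixedPointPreservingProducts.
Variables (T : finType) (x0 : T) (m : nat).
Variable sigma : 'I_m.+3 -> {perm T} -> {perm T}.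
Hypothesis fix_sigma : forall s : 'I_m.+3 -> {perm T},
  #|fixpts (\prod_i sigma i (s i))| = #|fixpts (\prod_i s i)|.

(** [psi] is [sigma] normalised by partial products of the [sigma k 1], so that
[psi i 1 = 1] while the product of the [psi i (s i)] is unchanged. *)
Let q k : {perm T} := oapp (sigma^~ 1) 1 (insub k).
Let r k := \prod_(0 <= i < k) q i.
Let psi (i : 'I_m.+3) a := r i * sigma i a * (r i.+1)^-1.

Let r0 : r 0 = 1. Proof. by rewrite /r big_nil. Qed.

Let r_last : r m.+3 = 1.
Proof.
apply/eqP; rewrite -card_fixpts_max /r big_mkord.
rewrite (eq_bigr (fun i => sigma i 1)); last by move=> i _; rewrite /q valK.
by rewrite fix_sigma big1 ?card_fixpts_max.
Qed.

Let psi1 i : psi i 1 = 1.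
Proof.
rewrite /psi {2}/r big_nat_recr //= /q valK /= -/(r i).
by rewrite invMg mulgA mulgK mulgV.
Qed.

Let fix_psi (s : 'I_m.+3 -> {perm T}) :
  #|fixpts (\prod_i psi i (s i))| = #|fixpts (\prod_i s i)|.
Proof.
rewrite /psi (big_ord_telescope _ (p := r) (q := fun k => (r k)^-1)).
- by rewrite r_last r0 invg1 /= mul1g mulg1 fix_sigma.
- by move=> k; apply: mulVg.
by rewrite /= mulgV.
Qed.

(** The identity is the only permutation with [#|T|] fixed points, so [psi]
sends products equal to 1 to products equal to 1. *)
Let psi_pair i j a : i != j -> psi i a = (psi j a^-1)^-1.
Proof.
move=> ij; pose s k := if k == i then a else if k == j then a^-1 else 1.
have si : s i = a by rewrite /s eqxx.
have sj : s j = a^-1 by rewrite /s eqxx eq_sym (negPf ij).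
have s1 k : k != i -> k != j -> s k = 1 by rewrite /s => /negPf-> /negPf->.
have prod_s1 : \prod_k psi k (s k) = 1.
  apply/eqP; rewrite -card_fixpts_max fix_psi card_fixpts_max.
  move: (ij); rewrite -val_eqE neq_ltn => /orP[lt | lt].
    by rewrite (big_ord_two _ lt s1) si sj /= mulgV.
  by rewrite (big_ord_two _ lt) => [|k kj ki]; rewrite ?si ?sj /= ?mulVg // s1.
have psi_s1 k : k != i -> k != j -> psi k (s k) = 1.
  by move=> ki kj; rewrite s1.
move: (ij); rewrite -val_eqE neq_ltn => /orP[lt | lt]; move: prod_s1.
  rewrite (big_ord_two _ lt psi_s1) si sj => E.
  by apply: (mulIg (psi j a^-1)); rewrite mulVg.
rewrite (big_ord_two _ lt) => [|k kj ki]; last exact: psi_s1.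
by rewrite si sj => E; apply: (mulgI (psi j a^-1)); rewrite mulgV.
Qed.

(** With three slots, any two distinct ones can be compared through a third. *)
Let psi_const i : psi i =1 psi ord0.
Proof.
move=> a; have [->//|i0] := eqVneq i ord0.
pose j : 'I_m.+3 :=
  if i == lift ord0 ord0 then lift ord0 (lift ord0 ord0) else lift ord0 ord0.
rewrite (@psi_pair i j) 1?(@psi_pair ord0 j) //.
  by rewrite /j; case: ifP.
by rewrite /j; case: ifP => [/eqP-> | /negbT].
Qed.

Let psiM : {morph psi ord0 : a b / a * b}.
Proof.
move=> a b; pose s (k : 'I_m.+3) :=
  if val k == 0%N then a else if val k == 1%N then b else
  if val k == 2%N then (a * b)^-1 else 1.
have prod_s1 : \prod_k psi k (s k) = 1.
  apply/eqP; rewrite -card_fixpts_max fix_psi card_fixpts_max.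
  rewrite big_ord_three => [|[[|[|[]]] //]].
  by rewrite /s /= mulgA mulgV.
move: prod_s1; rewrite big_ord_three => [|k k2]; last first.
  by rewrite /s; case: k k2 => [[|[|[|k]]] //] *; apply: psi1.
rewrite /= mulgA !psi_const /s /= => prod_s1.
have := @psi_pair ord0 (lift ord0 ord0) (a * b) isT.
rewrite psi_const => ->; apply: (mulIg (psi ord0 (a * b)^-1)).
by rewrite mulVg prod_s1.
Qed.

Lemma fixpts_prod_inner :
  exists p : nat -> {perm T}, p m.+3 = p 0 /\
    forall (i : 'I_m.+3) a, sigma i a = p i * a * (p i.+1)^-1.
Proof.
have fix_psi0 a : #|fixpts (psi ord0 a)| = #|fixpts a|.
  have := fix_psi (fun k => if val k == 0%N then a else 1).
  rewrite !big_ord_recl !big1 => [|k _|k _] //=; rewrite ?psi1 //.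
  by rewrite !mulg1.
have [t Et] := fixpts_morph_inner x0 psiM fix_psi0.
exists (fun k => (t * r k)^-1); split; first by rewrite r0 r_last.
move=> i a.
have -> : sigma i a = (r i)^-1 * psi i a * r i.+1.
  by rewrite /psi !mulgA mulVg mul1g mulgKV.
by rewrite psi_const Et conjgE invMg invgK !mulgA.
Qed.

End FixedPointPreservingProducts.

Local Close Scope group_scope.
Local Open Scope ring_scope.

(** * Permutation matrices *)

Section PermutationMatrices.
Variable R : numDomainType.
Implicit Types n : nat.

Lemma mxtrace_perm n (s : 'S_n) : \tr (perm_mx s : 'M[R]_n) = #|fixpts s|%:R.
Proof.
rewrite /mxtrace -sum1_card natr_sum [RHS]big_mkcond /=.
by apply: eq_bigr => i _; rewrite !mxE inE; case: eqP.
Qed.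

Lemma perm_mx_inj n : injective (fun s : 'S_n => perm_mx s : 'M[R]_n).
Proof.
move=> s t /matrixP eq_st; apply/permP=> i; have := eq_st i (t i).
rewrite !mxE eqxx; case: eqP => // _ /eqP.
by rewrite eq_sym oner_eq0.
Qed.

Lemma prod_perm_mx n m (s : 'I_m -> 'S_n) :
  \prod_i (perm_mx (s i) : 'M[R]_n) = perm_mx (\prod_i s i)%g.
Proof.
by apply/esym/big_morph; [exact: perm_mxM | exact: perm_mx1].
Qed.

Lemma mulmx_perm_mxV n (s : 'S_n) :
  (perm_mx s : 'M[R]_n) *m perm_mx s^-1 = 1%:M.
Proof. by rewrite -perm_mxM mulgV perm_mx1. Qed.

Lemma mulmx_perm_mxVl n (s : 'S_n) :
  (perm_mx s^-1 : 'M[R]_n) *m perm_mx s = 1%:M.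
Proof. by rewrite -perm_mxM mulVg perm_mx1. Qed.

(** Comparing two permutations that differ by a transposition gives
[X j i + X l k = X l i + X j k] for all indices; summing over [k] and [l]
leaves only [n ^ 2 * X j i = 0]. *)
Lemma mxtrace_perm_eq0 n (X : 'M[R]_n) :
  (forall i, \sum_j X i j = 0) -> (forall j, \sum_i X i j = 0) ->
  (forall s, \tr (perm_mx s *m X) = 0) -> X = 0.
Proof.
move=> rowX colX trX; apply/matrixP=> j i; rewrite mxE.
have sumX (s : 'S_n) : \sum_k X (s k) k = 0.
  rewrite -[RHS](trX s) -row_permE /mxtrace.
  by apply: eq_bigr => k _; rewrite mxE.
have cross k l : X j i + X l k = X l i + X j k.
  have [->|ki] := eqVneq k i; first by rewrite addrC.
  have [->|lj] := eqVneq l j; first by [].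
  pose s := (tperm i j * tperm (tperm i j k) l)%g.
  have kj : tperm i j k != j by rewrite -{2}(tpermL i j) (inj_eq perm_inj).
  have si : s i = j by rewrite permM tpermL tpermD // eq_sym.
  have sk : s k = l by rewrite permM tpermL.
  move: s si sk => s si sk.
  have := etrans (sumX (tperm i k * s)%g) (esym (sumX s)).
  rewrite (bigD1 i) //= (bigD1 k) //= [RHS](bigD1 i) //= [in RHS](bigD1 k) //=.
  rewrite !permM tpermL tpermR si sk !addrA.
  under eq_bigr => h /andP[hi hk] do rewrite permM tpermD 1?eq_sym //.
  by move/addIr=> ->.
have : \sum_k \sum_l (X j i + X l k) = \sum_k \sum_l (X l i + X j k).
  by apply: eq_bigr => k _; apply: eq_bigr => l _; apply: cross.
under eq_bigr do rewrite big_split /= colX addr0 sumr_const.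
under [RHS]eq_bigr do rewrite big_split /= colX add0r sumr_const.
rewrite [RHS]sumrMnl rowX mul0rn sumr_const card_ord -mulrnA => /eqP.
rewrite mulrn_eq0 muln_eq0 orbb => /orP[/eqP n0 | /eqP//].
by have n_gt0 := leq_ltn_trans (leq0n _) (ltn_ord j); rewrite n0 in n_gt0.
Qed.

End PermutationMatrices.

(** * Doubly stochastic matrices *)

Section DoublyStochasticMatrices.
Variables (R : realType) (n : nat).
Implicit Types A B : 'M[R]_n.

Lemma doubly_stochasticP A :
  reflect [/\ forall i j, 0 <= A i j, forall i, \sum_j A i j = 1
            & forall j, \sum_i A i j = 1] (doubly_stochastic A).
Proof.
apply: (iffP and3P) => [] [A0 rA cA]; split.
- by move=> i j; move/forallP/(_ i)/forallP/(_ j): A0.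
- by move=> i; apply/eqP; move/forallP/(_ i): rA.
- by move=> j; apply/eqP; move/forallP/(_ j): cA.
- by apply/forallP=> i; apply/forallP=> j; apply: A0.
- by apply/forallP=> i; apply/eqP/rA.
- by apply/forallP=> j; apply/eqP/cA.
Qed.

Lemma doubly_stochastic_mul A B :
  doubly_stochastic A -> doubly_stochastic B -> doubly_stochastic (A *m B).
Proof.
case/doubly_stochasticP=> A0 rA cA /doubly_stochasticP[B0 rB cB].
apply/doubly_stochasticP; split=> [i j|i|j].
- by rewrite mxE; apply: sumr_ge0 => k _; apply: mulr_ge0.
- under eq_bigr do rewrite mxE.
  rewrite exchange_big -[RHS](rA i) /=; apply: eq_bigr => k _.
  by rewrite -mulr_sumr rB mulr1.
under eq_bigr do rewrite mxE.
rewrite exchange_big -[RHS](cB j) /=; apply: eq_bigr => k _.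
by rewrite -mulr_suml cA mul1r.
Qed.

Lemma doubly_stochastic_perm s : doubly_stochastic (perm_mx s : 'M[R]_n).
Proof.
apply/doubly_stochasticP; split=> [i j|i|j].
- by rewrite !mxE ler0n.
- rewrite (bigD1 (s i)) //= big1 ?addr0 => [|j ji]; first by rewrite !mxE eqxx.
  by rewrite !mxE eq_sym (negPf ji).
rewrite (bigD1 (s^-1 j)%g) //= big1 ?addr0 => [|i ij].
  by rewrite !mxE permKV eqxx.
by rewrite !mxE -(inj_eq (@perm_inj _ s^-1%g)) permK (negPf ij).
Qed.

Lemma doubly_stochastic1 : doubly_stochastic (1%:M : 'M[R]_n).
Proof. by rewrite -perm_mx1 doubly_stochastic_perm. Qed.

Lemma doubly_stochastic_prod (I : Type) (r : seq I) (F : I -> 'M[R]_n) :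
  (forall i, doubly_stochastic (F i)) -> doubly_stochastic (\prod_(i <- r) F i).
Proof.
move=> dsF; apply: (big_ind (@doubly_stochastic R n)) => //.
- exact: doubly_stochastic1.
- exact: doubly_stochastic_mul.
Qed.

Lemma doubly_stochastic_le1 A i j : doubly_stochastic A -> A i j <= 1.
Proof.
case/doubly_stochasticP=> A0 rA _; rewrite -(rA i) (bigD1 j) //= lerDl.
exact: sumr_ge0.
Qed.

Lemma doubly_stochastic_trace_max A :
  doubly_stochastic A -> \tr A = n%:R -> A = 1%:M.
Proof.
move=> dsA trA; have [A0 rA _] := doubly_stochasticP _ dsA.
have diag i : A i i = 1.
  apply/eqP; rewrite -subr_eq0; apply/eqP.
  have sum0 : \sum_k (1 - A k k) = 0.
    by rewrite sumrB sumr_const card_ord -/(\tr A) trA subrr.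
  apply/eqP; rewrite -oppr_eq0 opprB; apply/eqP.
  apply: (psumr_eq0P _ sum0) => // k _.
  by rewrite subr_ge0 doubly_stochastic_le1.
apply/matrixP=> i j; rewrite mxE; have [<-|ij] := eqVneq i j; first exact: diag.
have : \sum_(k | k != i) A i k = 0.
  by have := rA i; rewrite (bigD1 i) //= diag -[X in _ = X]addr0 => /addrI.
by move/psumr_eq0P; apply=> //; rewrite eq_sym.
Qed.

Lemma doubly_stochastic_01_perm A : doubly_stochastic A ->
  (forall i j, A i j = 0 \/ A i j = 1) -> is_perm_mx A.
Proof.
case/doubly_stochasticP=> A0 rA cA A01.
have ex1 i : exists j, A i j == 1.
  apply/existsP; apply: contraT => /existsPn no1; have := rA i.
  rewrite big1 => [/esym/eqP | j _]; first by rewrite oner_eq0.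
  by case: (A01 i j) => // Aij; have := no1 j; rewrite Aij eqxx.
have [f fP] := fin_all_exists ex1.
have f_inj : injective f.
  move=> i k fik; apply/eqP; apply: contraT => ik.
  have := cA (f i); rewrite (bigD1 i) //= (bigD1 k) 1?eq_sym //=.
  rewrite (eqP (fP i)) {1}fik (eqP (fP k)) => /eqP.
  rewrite -subr_eq0 addrAC subrr add0r gt_eqF //.
  by apply: ltr_wpDr => //; apply: sumr_ge0.
apply/is_perm_mxP; exists (perm f_inj); apply/matrixP=> i j.
rewrite !mxE permE; case: eqP => [<-|/eqP fj]; first exact/eqP.
have : \sum_(k | k != f i) A i k = 0.
  have := rA i; rewrite (bigD1 (f i)) //= (eqP (fP i)) -[X in _ = X]addr0.
  exact: addrI.
by move/psumr_eq0P; apply=> //; rewrite eq_sym.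
Qed.

(** The diagonal of [A *m B] says that [\sum_j A i j * B j i = 1], which is also
[\sum_j A i j] and [\sum_j B j i]. Since entries are at most 1, these sums agree
term by term: [A i j = A i j * B j i = B j i], so [A i j] is idempotent. *)
Lemma doubly_stochastic_inv_perm A B : doubly_stochastic A ->
  doubly_stochastic B -> A *m B = 1%:M -> is_perm_mx A.
Proof.
move=> dsA dsB AB1.
have [A0 rA cA] := doubly_stochasticP _ dsA.
have [B0 rB cB] := doubly_stochasticP _ dsB.
have le1A i j : 0 <= 1 - A i j by rewrite subr_ge0 doubly_stochastic_le1.
have le1B i j : 0 <= 1 - B i j by rewrite subr_ge0 doubly_stochastic_le1.
have diag i : \sum_j A i j * B j i = 1.
  by move/matrixP/(_ i i): AB1; rewrite !mxE eqxx.
have EA i j : A i j = A i j * B j i.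
  apply/eqP; rewrite -subr_eq0 -{1}[A i j]mulr1 -mulrBr; apply/eqP.
  suff s0 : \sum_k A i k * (1 - B k i) = 0.
    by apply: (psumr_eq0P _ s0) => // k _; apply: mulr_ge0.
  by under eq_bigr do rewrite mulrBr mulr1; rewrite sumrB diag rA subrr.
have EB i j : B j i = A i j * B j i.
  apply/eqP; rewrite -subr_eq0 -{1}[B j i]mul1r -mulrBl; apply/eqP.
  suff s0 : \sum_k (1 - A i k) * B k i = 0.
    by apply: (psumr_eq0P _ s0) => // k _; apply: mulr_ge0.
  by under eq_bigr do rewrite mulrBl mul1r; rewrite sumrB diag cB subrr.
apply: doubly_stochastic_01_perm => // i j.
have /eqP : A i j * (1 - A i j) = 0.
  have EAB : A i j = B j i by rewrite EA -EB.
  by rewrite mulrBr mulr1 {3}EAB -EA subrr.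
by rewrite mulf_eq0 subr_eq0 => /orP[]/eqP ->; [left | right].
Qed.

(** If the whole product is the permutation matrix of [s], the first factor is
invertible with doubly stochastic inverse: the product of the others, times the
permutation matrix of [s^-1]. *)
Lemma doubly_stochastic_prod_perm (I : eqType) (r : seq I) (F : I -> 'M[R]_n) :
  (forall i, doubly_stochastic (F i)) -> is_perm_mx (\prod_(i <- r) F i) ->
  {in r, forall i, is_perm_mx (F i)}.
Proof.
move=> dsF; elim: r => // i r IHr; rewrite big_cons -mulmxE => permFr.
have permFi : is_perm_mx (F i).
  have [s Es] := is_perm_mxP _ permFr.
  apply: (@doubly_stochastic_inv_perm _ ((\prod_(j <- r) F j) *m perm_mx s^-1)).
  - exact: dsF.
  - apply: doubly_stochastic_mul; first exact: doubly_stochastic_prod.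
    exact: doubly_stochastic_perm.
  by rewrite mulmxA Es mulmx_perm_mxV.
move=> j; rewrite inE => /predU1P[-> //|]; apply: IHr.
by rewrite is_perm_mxMl in permFr.
Qed.

Definition DS_perm s : DS R n := MkDS (doubly_stochastic_perm s).

End DoublyStochasticMatrices.

(** * Maps that preserve traces of products *)

Section TracePreservingMaps.
Variables (R : realType) (n m : nat) (n_gt0 : (0 < n)%N).
Variable phi : 'I_m.+3 -> DS R n -> DS R n.
Hypothesis trace_phi : forall A : 'I_m.+3 -> DS R n,
  \tr (\prod_i (phi i (A i) : 'M[R]_n)) = \tr (\prod_i (A i : 'M[R]_n)).

Lemma trace_preserver_perm i s :
  exists t, (phi i (DS_perm R s) : 'M[R]_n) = perm_mx t.
Proof.
have [j ij] := ord_neq_ex i.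
pose a k : 'S_n := if k == i then s else if k == j then s^-1%g else 1%g.
have prod_a : (\prod_k a k)%g = 1%g.
  have ai : a i = s by rewrite /a eqxx.
  have aj : a j = s^-1%g by rewrite /a eqxx (negPf ij).
  have a1 k : k != i -> k != j -> a k = 1%g by rewrite /a => /negPf-> /negPf->.
  move: (ij); rewrite -val_eqE neq_ltn => /orP[lt | lt].
    rewrite (big_ord_two _ lt) => [|k kj ki]; last exact: a1.
    by rewrite ai aj /= mulVg.
  by rewrite (big_ord_two _ lt a1) ai aj /= mulgV.
have prod1 : \prod_k (phi k (DS_perm R (a k)) : 'M[R]_n) = 1%:M.
  apply: doubly_stochastic_trace_max.
    by apply: doubly_stochastic_prod => k; apply: DS_mxP.
  by rewrite trace_phi prod_perm_mx prod_a perm_mx1 mxtrace1.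
have : is_perm_mx (phi i (DS_perm R (a i)) : 'M[R]_n).
  apply: (@doubly_stochastic_prod_perm _ _ _ (index_enum _)
    (fun k => phi k (DS_perm R (a k)) : 'M[R]_n)) => [k||].
  - exact: DS_mxP.
  - by rewrite prod1 is_perm_mx1.
  exact: mem_index_enum.
by rewrite /a eqxx => /is_perm_mxP.
Qed.

Lemma trace_preserver_perm_conj : exists p : nat -> 'S_n, p m.+3 = p 0 /\
  forall (i : 'I_m.+3) (A : DS R n),
    (phi i A : 'M[R]_n) = perm_mx (p i) *m A *m perm_mx (p i.+1)^-1.
Proof.
have [sigma sigmaP] :=
  fin_all_exists (fun i => fin_all_exists (trace_preserver_perm i)).
have fix_sigma (s : 'I_m.+3 -> 'S_n) :
    #|fixpts (\prod_i sigma i (s i))%g| = #|fixpts (\prod_i s i)%g|.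
  apply/eqP; rewrite -(eqr_nat R) -!mxtrace_perm -!prod_perm_mx; apply/eqP.
  rewrite -(trace_phi (fun i => DS_perm R (s i))); congr (\tr _).
  by apply: eq_bigr => i _; rewrite sigmaP.
have [p [p_last pP]] := fixpts_prod_inner (Ordinal n_gt0) fix_sigma.
exists p; split=> // i A.
have [j ij] := ord_neq_ex i.
(* [Y k] is [phi k] with the permutations [p k] undone; it fixes all permutation
   matrices, and the goal is that it fixes [A]. *)
pose Y (k : 'I_m.+3) (B : DS R n) : 'M[R]_n :=
  perm_mx (p k)^-1 *m phi k B *m perm_mx (p k.+1).
have phiY k B :
    phi k B = perm_mx (p k) *m Y k B *m perm_mx (p k.+1)^-1 :> 'M[R]_n.
  by rewrite /Y !mulmxA mulmx_perm_mxV mul1mx -mulmxA mulmx_perm_mxV mulmx1.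
have Yperm k s : Y k (DS_perm R s) = perm_mx s.
  by rewrite /Y sigmaP pP -!perm_mxM !mulgA mulVg mul1g -mulgA mulVg mulg1.
have traceY (B : 'I_m.+3 -> DS R n) :
    \tr (\prod_k Y k (B k)) = \tr (\prod_k (B k : 'M[R]_n)).
  rewrite -trace_phi; under [in RHS]eq_bigr do rewrite phiY.
  rewrite (big_ord_telescope _ (p := fun k => perm_mx (p k))
     (q := fun k => perm_mx (p k)^-1)) /= => [|k|]; last 2 first.
  - exact: mulmx_perm_mxVl.
  - exact: mulmx_perm_mxV.
  by rewrite p_last -!mulmxE mxtrace_mulC mulmxA mulmx_perm_mxVl mul1mx.
suff -> : (A : 'M[R]_n) = Y i A by [].
apply/eqP; rewrite eq_sym -subr_eq0; apply/eqP.
have dsY : doubly_stochastic (Y i A).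
  by do 2?apply: doubly_stochastic_mul; rewrite ?doubly_stochastic_perm ?DS_mxP.
have [_ rY cY] := doubly_stochasticP _ dsY.
have [_ rA cA] := doubly_stochasticP _ (DS_mxP A).
apply: mxtrace_perm_eq0 => [k|k|s].
- by under eq_bigr do rewrite mxE [X in _ + X]mxE; rewrite sumrB rY rA subrr.
- by under eq_bigr do rewrite mxE [X in _ + X]mxE; rewrite sumrB cY cA subrr.
rewrite mulmxBr raddfB /=; apply/eqP; rewrite subr_eq0; apply/eqP.
pose B k := if k == i then A else if k == j then DS_perm R s else DS_perm R 1.
have Bi : B i = A by rewrite /B eqxx.
have Bj : B j = DS_perm R s by rewrite /B eqxx (negPf ij).
have B1 k : k != i -> k != j -> B k = DS_perm R 1.
  by rewrite /B => /negPf-> /negPf->.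
have B1mx k : k != i -> k != j -> (B k : 'M[R]_n) = 1.
  by move=> ki kj; rewrite B1 //= perm_mx1.
have Y1 k : k != i -> k != j -> Y k (B k) = 1.
  by move=> ki kj; rewrite B1 // Yperm perm_mx1.
have := traceY B; move: (ij); rewrite -val_eqE neq_ltn => /orP[lt | lt].
  rewrite !(big_ord_two _ lt) /= => [|k kj ki|k kj ki].
  - by rewrite Bi Bj Yperm.
  - exact: B1mx.
  - exact: Y1.
rewrite (big_ord_two _ lt Y1) (big_ord_two _ lt B1mx) /= Bi Bj Yperm -!mulmxE.
by rewrite ![\tr (_ *m perm_mx s)]mxtrace_mulC.
Qed.

End TracePreservingMaps.

(** * Spectra *)

Section Spectra.

Lemma char_poly_conj (K : comNzRingType) n (P Q A : 'M[K]_n) :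
  P *m Q = 1%:M -> char_poly (P *m A *m Q) = char_poly A.
Proof.
move=> PQ1; have PQ1' : map_mx polyC P *m map_mx polyC Q = 1%:M.
  by rewrite -map_mxM PQ1 map_mx1.
have -> : char_poly (P *m A *m Q) =
    \det (map_mx polyC P *m char_poly_mx A *m map_mx polyC Q).
  congr (\det _); rewrite /char_poly_mx mulmxBr mulmxBl !map_mxM.
  by rewrite scalar_mxC -[_%:M *m _ *m _]mulmxA PQ1' mulmx1.
by rewrite !det_mulmx mulrAC -det_mulmx PQ1' det1 mul1r.
Qed.

Lemma spectrum_char_poly (C : closedFieldType) n (A B : 'M[C]_n) :
  spectrum A = spectrum B <-> char_poly A = char_poly B.
Proof.
split=> [/eqP/spectrumP -> | eqAB]; last by rewrite /spectrum eqAB.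
by apply/esym/spectrumP.
Qed.

Lemma spec_trace (R : realType) n (A B : 'M[R]_n) :
  (0 < n)%N -> spec A = spec B -> \tr A = \tr B.
Proof.
move=> n_gt0 /spectrum_char_poly eqAB.
have /oppr_inj :
    - \tr (map_mx (real_complex R) A) = - \tr (map_mx (real_complex R) B).
  by rewrite -!char_poly_trace // eqAB.
by rewrite !trace_map_mx => /(fmorph_inj (real_complex R)).
Qed.

Lemma spec_conj (R : realType) n (P Q A : 'M[R]_n) :
  P *m Q = 1%:M -> spec (P *m A *m Q) = spec A.
Proof.
move=> PQ1; apply/spectrum_char_poly; rewrite !map_mxM.
by apply: char_poly_conj; rewrite -map_mxM PQ1 map_mx1.
Qed.

End Spectra.

Theorem theorem3p3 (R : realType) (n m : nat) (n_gt0 : (0 < n)%N)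
    (m_ge3 : (3 <= m)%N) (phi : 'I_m -> DS R n -> DS R n) :
  [<-> forall A : 'I_m -> DS R n,
         \tr (\prod_(i < m) (phi i (A i) : 'M[R]_n)) =
         \tr (\prod_(i < m) (A i : 'M[R]_n));
       forall A : 'I_m -> DS R n,
         spec (\prod_(i < m) (phi i (A i) : 'M[R]_n)) =
         spec (\prod_(i < m) (A i : 'M[R]_n));
       exists P : 'I_m.+1 -> 'M[R]_n,
         [/\ forall k : 'I_m.+1, is_perm_mx (P k),
             P ord_max = P ord0
           & forall (i : 'I_m) (A : DS R n),
               phi i A = P (widen_ord (leqnSn m) i) *m A *m
                         (P (lift ord0 i))^T :> 'M[R]_n]].
Proof.
case: m m_ge3 phi => [|[|[|m]]] // _ phi.
have spec_to_trace : (forall A : 'I_m.+3 -> DS R n,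
    spec (\prod_i (phi i (A i) : 'M[R]_n)) = spec (\prod_i (A i : 'M[R]_n))) ->
  forall A : 'I_m.+3 -> DS R n,
    \tr (\prod_i (phi i (A i) : 'M[R]_n)) = \tr (\prod_i (A i : 'M[R]_n)).
  by move=> spec_phi A; apply: spec_trace.
have conj_to_spec (p : nat -> 'S_n) : p m.+3 = p 0 ->
    (forall (i : 'I_m.+3) (A : DS R n),
      (phi i A : 'M[R]_n) = perm_mx (p i) *m A *m perm_mx (p i.+1)^-1) ->
  forall A : 'I_m.+3 -> DS R n,
    spec (\prod_i (phi i (A i) : 'M[R]_n)) = spec (\prod_i (A i : 'M[R]_n)).
  move=> p_last phiE A; under eq_bigr do rewrite phiE.
  rewrite (big_ord_telescope _ (p := fun k => perm_mx (p k))
     (q := fun k => perm_mx (p k)^-1)) /= => [|k|]; last 2 first.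
  - exact: mulmx_perm_mxVl.
  - exact: mulmx_perm_mxV.
  by rewrite p_last -!mulmxE spec_conj // mulmx_perm_mxV.
tfae.
- move=> trace_phi.
  have [p [p_last phiE]] := trace_preserver_perm_conj n_gt0 trace_phi.
  exact: conj_to_spec p_last phiE.
- move/spec_to_trace => trace_phi.
  have [p [p_last phiE]] := trace_preserver_perm_conj n_gt0 trace_phi.
  exists (fun k => perm_mx (p k)); split=> [k||i A].
  - exact: perm_mx_is_perm.
  - by rewrite /= p_last.
  by rewrite phiE tr_perm_mx lift0.
case=> P [P_perm P_last phiE]; apply: spec_to_trace.
have [s sP] := fin_all_exists (fun k => is_perm_mxP _ (P_perm k)).
apply: (conj_to_spec (fun k => s (inord k))) => [|i A].
  have -> : inord m.+3 = ord_max :> 'I_m.+4.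
    by apply: val_inj; rewrite /= inordK.
  have -> : inord 0 = ord0 :> 'I_m.+4 by apply: val_inj; rewrite /= inordK.
  by move: P_last; rewrite !sP => /perm_mx_inj.
have <- : widen_ord (leqnSn m.+3) i = inord i :> 'I_m.+4.
  by apply: val_inj; rewrite /= inordK // ltnW // ltnS ltn_ord.
have <- : lift ord0 i = inord i.+1 :> 'I_m.+4.
  by apply: val_inj; rewrite /= inordK // ltnS ltn_ord.
by rewrite phiE !sP tr_perm_mx.
Qed.
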